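(* Let $m\ge1$, let $\phi:[0,1]^m\to[0,1]^m$ be a Lipschitz continuous map with Lipschitz constant $L_\phi$ and partial Lipschitz constants $L_\phi^{(l)}$, $l=1,\dots,m$, let $\mathcal{K}f=f\circ\phi$ be the associated Koopman operator, and let $\mathbf{n}=(n_1,\dots,n_m)$ have positive integer entries. For $f\in C([0,1]^m)$ and every integer $k\geq1$, $$\|(\mathcal{B}_\mathbf{n}\mathcal{K})^kf-\mathcal{K}^kf\|_\infty\leq\frac{3}{2}\sum_{j=0}^{k-1}\Omega_{(\mathcal{B}_\mathbf{n}\mathcal{K})^jf}\left(L_\phi\sqrt{\sum_{l=1}^m\frac{1}{n_l}}\right)$$ and $$\|(\mathcal{B}_\mathbf{n}\mathcal{K})^kf-\mathcal{K}^kf\|_\infty\leq\frac{3}{2}\sum_{j=0}^{k-1}\sum_{l=1}^m\Omega_{(\mathcal{B}_\mathbf{n}\mathcal{K})^jf}\left(\frac{L_\phi^{(l)}}{\sqrt{n_l}}\right).$$ Moreover, if the partial derivatives $\partial_l\phi:[0,1]^m\to\mathbb{R}^m$ are also Lipschitz continuous, with partial Lipschitz constant $L^{(l)}_{\partial_l\phi}$ (with respect to the $l$th variable), for all $l$, then, for $f\in C^1([0,1]^m)$ and every integer $k\geq1$, $$\|(\mathcal{B}_\mathbf{n}\mathcal{K})^{k}f-\mathcal{K}^{k}f\|_\infty\leq\sum_{j=0}^{k-1}\sum_{l=1}^m\frac{1}{\sqrt{n_l}}\left(L^{(l)}_{\phi}\,\Omega_{\nabla((\mathcal{B}_\mathb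f{n}\mathcal{K})^jf)}\left(\frac{L^{(l)}_{\phi}}{2\sqrt{n_l}}\right)+\|\nabla((\mathcal{B}_\mathbf{n}\mathcal{K})^jf)\|_{\infty}\,\frac{L^{(l)}_{\partial_l\phi}}{2\sqrt{n_l}}\right).$$
   Context: $C([0,1]^m)$ (resp. $C^1([0,1]^m)$) is the space of continuous (resp. continuously differentiable) complex-valued functions on $[0,1]^m$; $\|\cdot\|$ is the Euclidean norm on vectors, $\|f\|_\infty=\sup_{\mathbf{x}\in[0,1]^m}|f(\mathbf{x})|$, and for vector-valued $g$, $\|g\|_\infty=\sup_{\mathbf{x}\in[0,1]^m}\|g(\mathbf{x})\|$. The Bernstein operator $\mathcal{B}_\mathbf{n}:C([0,1]^m)\to C([0,1]^m)$ is $$(\mathcal{B}_\mathbf{n}f)(\mathbf{x})=\mathcal{B}_\mathbf{n}(f;\mathbf{x})=\sum_{k_1=0}^{n_1}\cdots\sum_{k_m=0}^{n_m} f\left(\tfrac{k_1}{n_1},\dots,\tfrac{k_m}{n_m}\right)\prod_{l=1}^m b_{n_l,k_l}(x_l),\qquad b_{n,k}(x)=\binom{n}{k}x^k(1-x)^{n-k}.$$ A Lipschitz constant of $\phi$ is any real $L_\phi\ge0$ with $\|\phi(\mathbf{x})-\phi(\mathbf{y})\|\le L_\phi\|\mathbf{x}-\mathbf{y}\|$ for all $\mathbf{x},\mathbf{y}$. A partial Lipschitz constant $L_g^{(l)}\ge0$ of a map $g:[0,1]^m\to\mathbb{R}^m$ is a real number such that $\|g(\mathbf{x})-g(\mathbf{y})\|\le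 L_g^{(l)}|x_l-y_l|$ for all $\mathbf{x},\mathbf{y}\in[0,1]^m$ that differ only in their $l$th coordinate. For a scalar- or vector-valued function $g$ on $[0,1]^m$ and $\delta\ge0$, the full modulus of continuity is $\Omega_g(\delta)=\sup\{\|g(\mathbf{x})-g(\mathbf{y})\|:\mathbf{x},\mathbf{y}\in[0,1]^m,\ \|\mathbf{x}-\mathbf{y}\|\le\delta\}$ (with absolute value in the scalar case). Powers of operators denote iteration, with $(\mathcal{B}_\mathbf{n}\mathcal{K})^0$ the identity. *)

(* Defs.v *)
From HB Require Import structures.
From mathcomp Require Export all_boot all_order all_algebra.
From mathcomp Require Export all_classical all_reals all_analysis.
From mathcomp.real_closed Require Export complex.

Set Implicit Arguments.
Unset Strict Implicit.
Unset Printing Implicit Defensive.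

Export Order.TTheory GRing.Theory Num.Theory.
Export numFieldNormedType.Exports.
Export ComplexField.Normc.

#[export] Set Implicit Arguments.
#[export] Unset Strict Implicit.
#[export] Unset Printing Implicit Defensive.

Local Open Scope classical_set_scope.
Local Open Scope ring_scope.
Local Open Scope complex_scope.

Section Cube.
Variables (R : realType) (m : nat).

(* A function on [0,1]^m is a total function on 'rV[R]_m of which only the
   values on [cube] are ever used. *)
Definition cube : set 'rV[R]_m := [set x | forall l, 0 <= x 0 l <= 1].

(* Euclidean norms, on R^m and on C^m.  The library norm `|x| on row vectors is
   the max norm, and `|z| on R[i] takes its values in R[i]; [normc z : R]. *)
Definition rnorm (v : 'rV[R]_m) : R := Num.sqrt (\sum_l v 0 l ^+ 2).
Definition cnorm (v : 'rV[R[i]]_m) : R := Num.sqrt (\sum_l normc (v 0 l) ^+ 2).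

(* The codomain W is R[i] (with N = normc), 'rV[R]_m (with N = rnorm) or
   'rV[R[i]]_m (with N = cnorm).  The real [sup] of an unbounded set is 0;
   these are only applied to functions that are bounded on the cube. *)
Definition supnorm (W : Type) (N : W -> R) (g : 'rV[R]_m -> W) : R :=
  sup [set N (g x) | x in cube].

Definition modulus (W : zmodType) (N : W -> R) (g : 'rV[R]_m -> W) (delta : R)
    : R :=
  sup [set r | exists x y, [/\ cube x, cube y, rnorm (x - y) <= delta
                             & r = N (g x - g y)]].

Definition lipschitz_const (g : 'rV[R]_m -> 'rV[R]_m) (L : R) : Prop :=
  0 <= L /\
  forall x y, cube x -> cube y -> rnorm (g x - g y) <= L * rnorm (x - y).

Definition partial_lipschitz_const (l : 'I_m) (g : 'rV[R]_m -> 'rV[R]_m)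
    (L : R) : Prop :=
  0 <= L /\
  forall x y, cube x -> cube y -> (forall i, i != l -> x 0 i = y 0 i) ->
    rnorm (g x - g y) <= L * `|x 0 l - y 0 l|.

Definition bernstein_poly (n k : nat) (t : R) : R :=
  'C(n, k)%:R * t ^+ k * (1 - t) ^+ (n - k)%N.

Definition bernstein (n : 'I_m -> nat) (f : 'rV[R]_m -> R[i])
    (x : 'rV[R]_m) : R[i] :=
  \sum_(k : {dffun forall l : 'I_m, 'I_(n l).+1})
    f (\row_l ((k l)%:R / (n l)%:R))
    * (\prod_l bernstein_poly (n l) (k l) (x 0 l))%:C.

Definition koopman (phi : 'rV[R]_m -> 'rV[R]_m) (f : 'rV[R]_m -> R[i])
    : 'rV[R]_m -> R[i] := f \o phi.

(* t -> 0 with t <> 0 and x + t e_l in the cube: two-sided if 0 < x_l < 1,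
   one-sided if x_l is 0 or 1. *)
Definition increment (l : 'I_m) (x : 'rV[R]_m) : set_system R :=
  within [set t | cube (x + t *: delta_mx 0 l)] 0^'.

(* R[i]^o is R[i] seen as a normed module over itself, which is where the
   library puts the usual topology of the complex plane. *)
Definition cquot (f : 'rV[R]_m -> R[i]) (l : 'I_m) (x : 'rV[R]_m) (t : R)
    : R[i]^o := (f (x + t *: delta_mx 0 l) - f x) / t%:C.

Definition vquot (g : 'rV[R]_m -> 'rV[R]_m) (l : 'I_m) (x : 'rV[R]_m) (t : R)
    : 'rV[R]_m := t^-1 *: (g (x + t *: delta_mx 0 l) - g x).

Definition cpartial (f : 'rV[R]_m -> R[i]) (l : 'I_m) (x : 'rV[R]_m) : R[i] :=
  lim (cquot f l x t @[t --> increment l x]).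

Definition vpartial (g : 'rV[R]_m -> 'rV[R]_m) (l : 'I_m) (x : 'rV[R]_m)
    : 'rV[R]_m :=
  lim (vquot g l x t @[t --> increment l x]).

Definition grad (f : 'rV[R]_m -> R[i]) (x : 'rV[R]_m) : 'rV[R[i]]_m :=
  \row_l cpartial f l x.

Definition continuous_on_cube (f : 'rV[R]_m -> R[i]) : Prop :=
  {within cube, continuous (f : 'rV[R]_m -> R[i]^o)}.

Definition C1_on_cube (f : 'rV[R]_m -> R[i]) : Prop :=
  continuous_on_cube f /\
  forall l : 'I_m,
    (forall x, cube x -> cvg (cquot f l x t @[t --> increment l x])) /\
    continuous_on_cube (cpartial f l).

Definition vpartial_exists (g : 'rV[R]_m -> 'rV[R]_m) (l : 'I_m) : Prop :=
  forall x, cube x -> cvg (vquot g l x t @[t --> increment l x]).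

End Cube.
Arguments cube {R m}.

(* Main.v *)
(** Write [K f = f \o phi] and [B] for the Bernstein operator, and telescope
    [(B K)^k - K^k = sum_j K^(k-1-j) (B K - K) (B K)^j]: since [phi] preserves
    the cube, [K] does not increase sup norms, so it is enough to bound
    [B K g - K g] on the cube for [g = (B K)^j f].

    [B h x] is the mean of [h] at a random grid point with independent binomial
    coordinates, of means [x_l] and variances at most [1 / (4 n_l)].  The first
    bound follows from [Omega (lam delta) <= (1 + lam) Omega delta].  For the
    other two the coordinates are randomised one at a time, which bounds the
    error of [B] by the sum of the errors of the one-variable operators.  In the
    [C^1] case the centred mean kills the first-order term
    [grad g (phi x) . d_l phi x], and the mean value inequality applied to
    [g \o phi] along the [l]th axis controls the remainder. *)

Require Import Defs.
From mathcomp Require Import ring lra.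

Local Open Scope classical_set_scope.
Local Open Scope ring_scope.
Local Open Scope complex_scope.

(** * The Bernstein basis in one variable *)

(** Distributivity for index types that depend on [i]. Through [fprod], dependent functions become
    tag-respecting functions into the tagged union, where the rule for a fixed codomain applies. *)
Lemma sum_dffun_prod (S : comNzRingType) (I : finType) (J : I -> finType)
    (F : forall i, J i -> S) :
  \sum_(k : {dffun forall i, J i}) \prod_i F i (k i)
  = \prod_i \sum_(j : J i) F i j.
Proof.
rewrite (reindex (@dffun_of_fprod I J)) /=; last first.
  exact/onW_bij/dffun_of_fprod_bij.
under eq_bigr => t _ do under eq_bigr => i _ do rewrite ffunE.
transitivity (\sum_(t : fprod J) \prod_i [ffun j => F i j] (t i)).
  by apply: eq_bigr => t _; apply: eq_bigr => i _; rewrite ffunE.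
rewrite big_fprod -(bigA_distr_big_dep (tagged_with J)
  (fun i => untag 0 [ffun j => F i j])).
apply: eq_bigr => i _.
rewrite -[LHS](big_tag (fun i (j : J i) => [ffun j => F i j] j) i).
by apply: eq_bigr => j _; rewrite ffunE.
Qed.

Section Bernstein1.
Variable R : realType.
Implicit Types (n k : nat) (t : R).

Lemma bernstein_poly_ge0 n k t : 0 <= t <= 1 -> 0 <= bernstein_poly n k t.
Proof.
move=> /andP[t0 t1].
by rewrite /bernstein_poly !mulr_ge0 ?exprn_ge0 ?subr_ge0 ?ler0n.
Qed.

Lemma sum_bernstein_poly n t : \sum_(k < n.+1) bernstein_poly n k t = 1.
Proof.
transitivity ((1 - t + t) ^+ n); last by rewrite subrK expr1n.
rewrite exprDn; apply: eq_bigr => k _.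
by rewrite -[RHS]mulr_natl /bernstein_poly -mulrA; congr (_ * _); exact: mulrC.
Qed.

(** Absorption, [k C(n,k) = n C(n-1,k-1)]: a factor [k] is traded for a drop in degree, which yields
    the first two moments. *)
Lemma natr_bernstein_poly n k t :
  k.+1%:R * bernstein_poly n.+1 k.+1 t = n.+1%:R * t * bernstein_poly n k t.
Proof.
rewrite /bernstein_poly subSS !mulrA -natrM -mul_bin_diag natrM exprS; ring.
Qed.

Lemma bernstein_mean n t :
  \sum_(k < n.+1) k%:R * bernstein_poly n k t = n%:R * t.
Proof.
case: n => [|n]; first by rewrite big_ord1 !mul0r.
rewrite big_ord_recl mul0r add0r.
under eq_bigr do rewrite natr_bernstein_poly.
by rewrite -mulr_sumr sum_bernstein_poly mulr1.
Qed.

Lemma bernstein_moment2 n t :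
  \sum_(k < n.+1) k%:R ^+ 2 * bernstein_poly n k t
  = n%:R * t * (1 - t + n%:R * t).
Proof.
case: n => [|n]; first by rewrite big_ord1 expr0n !mul0r.
rewrite big_ord_recl expr0n mul0r add0r.
rewrite (eq_bigr (fun k : 'I_n.+1 => n.+1%:R * t *
    (k%:R * bernstein_poly n k t + bernstein_poly n k t))); last first.
  move=> k _; rewrite lift0 expr2 -mulrA natr_bernstein_poly.
  by rewrite -[k.+1%:R]natr1; ring.
rewrite -mulr_sumr big_split /= sum_bernstein_poly bernstein_mean.
rewrite -[n.+1%:R]natr1; ring.
Qed.

Lemma bernstein_centered n t : (0 < n)%N ->
  \sum_(k < n.+1) bernstein_poly n k t * (k%:R / n%:R - t) = 0.
Proof.
move=> n0; have nz : n%:R != 0 :> R by rewrite pnatr_eq0 -lt0n.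
under eq_bigr do rewrite mulrBr (mulrC _ t) [X in X - _]mulrA (mulrC _ _%:R).
rewrite big_split /= -mulr_suml bernstein_mean sumrN -mulr_sumr.
by rewrite sum_bernstein_poly; field.
Qed.

(** The moments give the variance exactly, [t (1 - t) / n], and [t (1 - t) <= 1/4] because
    [(t - 1/2)^2 >= 0]. *)
Lemma bernstein_variance n t : (0 < n)%N ->
  \sum_(k < n.+1) bernstein_poly n k t * (k%:R / n%:R - t) ^+ 2
  <= (4%:R * n%:R)^-1.
Proof.
move=> n0; have nz : n%:R != 0 :> R by rewrite pnatr_eq0 -lt0n.
rewrite (eq_bigr (fun k : 'I_n.+1 => n%:R ^- 2 * (k%:R ^+ 2 * bernstein_poly n k t)
  + ((- (2%:R * t / n%:R)) * (k%:R * bernstein_poly n k t)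
     + t ^+ 2 * bernstein_poly n k t))); last by move=> k _; field.
rewrite !big_split /= -!mulr_sumr bernstein_moment2 bernstein_mean.
rewrite sum_bernstein_poly.
have -> : n%:R ^- 2 * (n%:R * t * (1 - t + n%:R * t)) +
  (- (2%:R * t / n%:R) * (n%:R * t) + t ^+ 2 * 1) = t * (1 - t) / n%:R :> R.
  by field.
rewrite invfM ler_wpM2r ?invr_ge0 //.
have := sqr_ge0 (t - 2^-1); nra.
Qed.

(** Mean deviation against standard deviation. With the parameter [s = sqrt n], both averaged terms
    of the AM-GM bound are at most [1 / (4 s)]. *)
Lemma bernstein_abs n t : (0 < n)%N -> 0 <= t <= 1 ->
  \sum_(k < n.+1) bernstein_poly n k t * `|k%:R / n%:R - t|
  <= (2%:R * Num.sqrt n%:R)^-1.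
Proof.
move=> n0 t01; set s := Num.sqrt n%:R.
have s0 : 0 < s by rewrite sqrtr_gt0 ltr0n.
have ns : n%:R = s ^+ 2 by rewrite sqr_sqrtr.
(* AM-GM: [|d| <= s d^2 + 1 / (4 s)] *)
have le d : `|d| <= s * d ^+ 2 + (4%:R * s)^-1.
  rewrite -(real_normK (num_real d)) -subr_ge0.
  have -> : s * `|d| ^+ 2 + (4%:R * s)^-1 - `|d| = (s * `|d| - 2^-1) ^+ 2 / s.
    by field; rewrite gt_eqF.
  by rewrite divr_ge0 ?sqr_ge0 ?ltW.
apply: (@le_trans _ _ (\sum_(k < n.+1)
  (s * (bernstein_poly n k t * (k%:R / n%:R - t) ^+ 2)
   + (4%:R * s)^-1 * bernstein_poly n k t))).
  apply: ler_sum => k _; apply: le_trans (ler_wpM2l _ (le _)) _.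
    exact: bernstein_poly_ge0.
  by rewrite mulrDr mulrCA [X in _ + X]mulrC.
rewrite big_split /= -!mulr_sumr sum_bernstein_poly mulr1.
apply: le_trans (lerD (ler_wpM2l (ltW s0) (bernstein_variance t n0)) (lexx _)) _.
rewrite ns le_eqVlt; apply/orP; left; apply/eqP; field.
by rewrite gt_eqF.
Qed.

End Bernstein1.

(** * Product weights and reduction to one variable *)

Section ProductWeights.
Variables (S : comNzRingType) (I : finType) (J : I -> finType).
Variable w : forall i, J i -> S.
Implicit Type k : {dffun forall i, J i}.

Definition resample k i (j : J i) : {dffun forall i, J i} :=
  [ffun l => eqtype.dfwith k j l].

Lemma resample_in k i (j : J i) : resample k j i = j.
Proof. by rewrite ffunE dfwith_in. Qed.

Lemma resample_out k i (j : J i) l : l != i -> resample k j l = k l.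
Proof. by move=> li; rewrite ffunE dfwith_out // eq_sym. Qed.

Lemma resampleK k i (j : J i) : resample (resample k j) (k i) = k.
Proof.
apply/ffunP => l; have [->|li] := eqVneq l i; first by rewrite resample_in.
by rewrite !resample_out.
Qed.

Definition weight k := \prod_i w (k i).

(* [(k, j) |-> (resample k j, k i)] is an involution that preserves
   [weight k * w j]. *)
Lemma sum_resample i (G : {dffun forall i, J i} -> S) :
  \sum_(j : J i) w j = 1 ->
  \sum_k G k * weight k
  = \sum_k (\sum_(j : J i) G (resample k j) * w j) * weight k.
Proof.
move=> w1.
transitivity (\sum_k \sum_(j : J i) G k * weight k * w j).
  by apply: eq_bigr => k _; rewrite -mulr_sumr w1 mulr1.
rewrite pair_big /=.
pose h (p : {dffun forall i, J i} * J i) := (resample p.1 p.2, p.1 i).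
have hK : involutive h.
  by case=> k j; rewrite /h /= resampleK resample_in.
rewrite (reindex_inj (inv_inj hK)) /=.
rewrite [RHS](eq_bigr (fun k => \sum_(j : J i) G (resample k j) * w j * weight k)).
  rewrite pair_big /=; apply: eq_bigr => -[k j] _ /=.
  rewrite -!mulrA; congr (_ * _).
  rewrite /weight (bigD1 i) //= [in RHS](bigD1 i) //= resample_in.
  rewrite (eq_bigr (fun l => w (k l))); first by rewrite mulrAC mulrA.
  by move=> l li; rewrite resample_out.
by move=> k _; rewrite mulr_suml.
Qed.

Hypothesis w1 : forall i, \sum_(j : J i) w j = 1.

Lemma sum_weight : \sum_k weight k = 1.
Proof. by rewrite sum_dffun_prod big1. Qed.

(** Resampling coordinate [i] makes the summand a constant, and the total weight is 1. *)
Lemma sum_marginal i (u : J i -> S) :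
  \sum_(k : {dffun forall i, J i}) u (k i) * weight k
  = \sum_(j : J i) u j * w j.
Proof.
rewrite (sum_resample (fun k : {dffun forall i, J i} => u (k i)) (w1 i)).
rewrite (eq_bigr (fun k => (\sum_(j : J i) u j * w j) * weight k)).
  by rewrite -mulr_sumr sum_weight mulr1.
move=> k _; congr (_ * _).
by apply: eq_bigr => j _; rewrite resample_in.
Qed.

End ProductWeights.

Section Hybrid.
Variables (R : realType) (m : nat).
Implicit Types (x y z : 'rV[R]_m) (t : R).

Definition upd x (l : 'I_m) t : 'rV[R]_m :=
  \row_i (if i == l then t else x 0 i).

Lemma upd_in x l t : upd x l t 0 l = t.
Proof. by rewrite mxE eqxx. Qed.

Lemma upd_out x l t i : i != l -> upd x l t 0 i = x 0 i.
Proof. by rewrite mxE => /negbTE->. Qed.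

Lemma upd_cube x l t : cube x -> 0 <= t <= 1 -> cube (upd x l t).
Proof. by move=> cx t01 i; rewrite mxE; case: ifP. Qed.

Lemma upd_id x l : upd x l (x 0 l) = x.
Proof. by apply/rowP => i; rewrite mxE; case: eqP => [->|]. Qed.

Variables (n : 'I_m -> nat) (n_gt0 : forall l, (0 < n l)%N).
Local Notation index := {dffun forall l : 'I_m, 'I_(n l).+1}.
Implicit Type k : index.

Lemma ratio01 p q : (0 < p)%N -> (q <= p)%N -> 0 <= (q%:R / p%:R : R) <= 1.
Proof.
move=> p0 qp; rewrite divr_ge0 ?ler0n // ler_pdivrMr ?ltr0n // mul1r.
by rewrite ler_nat.
Qed.

Lemma gridpoint01 l (j : 'I_(n l).+1) : 0 <= (j%:R / (n l)%:R : R) <= 1.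
Proof. by apply: ratio01 => //; rewrite -ltnS. Qed.

Definition bw x l (j : 'I_(n l).+1) : R := bernstein_poly (n l) j (x 0 l).

Lemma sum_bw x l : \sum_(j < (n l).+1) bw x j = 1.
Proof. exact: sum_bernstein_poly. Qed.

Lemma bw_ge0 x l (j : 'I_(n l).+1) : cube x -> 0 <= bw x j.
Proof. by move=> cx; exact: bernstein_poly_ge0. Qed.

Lemma weight_ge0 x k : cube x -> 0 <= weight (bw x) k.
Proof. by move=> cx; apply: prodr_ge0 => l _; exact: bw_ge0. Qed.

Lemma normc_sum (I : Type) (r : seq I) (P : pred I) (F : I -> R[i]) :
  normc (\sum_(i <- r | P i) F i) <= \sum_(i <- r | P i) normc (F i).
Proof.
elim/big_ind2: _ => [|a b c d ab cd|//]; first by rewrite normc0.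
exact: le_trans (le_normcD _ _) (lerD ab cd).
Qed.

Lemma normc_real t : normc t%:C = `|t|.
Proof. by rewrite /= expr0n /= addr0 sqrtr_sqr. Qed.

Lemma normc_ge0 (z : R[i]) : 0 <= normc z.
Proof. by case: z => a b; rewrite /= sqrtr_ge0. Qed.

Lemma bernsteinE (f : 'rV[R]_m -> R[i]) x :
  bernstein n f x = \sum_(k : index) f (\row_l ((k l)%:R / (n l)%:R)) * (weight (bw x) k)%:C.
Proof. by []. Qed.

Definition bernstein_coord l (h : 'rV[R]_m -> R[i]) x : R[i] :=
  \sum_(j < (n l).+1) h (upd x l (j%:R / (n l)%:R)) * (bw x j)%:C.

(** Hybrid argument: the coordinates of [x] are replaced by random grid coordinates one at a time.
    Each replacement changes the mean by an average of one-variable errors at hybrid points, which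
    is why [C l] has to bound the error at every [z] of the cube. *)
Lemma bernstein_error (h : 'rV[R]_m -> R[i]) (C : 'I_m -> R) x : cube x ->
  (forall l z, cube z -> normc (bernstein_coord l h z - h z) <= C l) ->
  normc (bernstein n h x - h x) <= \sum_l C l.
Proof.
move=> cx hC.
(* In [T p] only the first [p] coordinates are averaged. *)
pose pt (p : nat) k : 'rV[R]_m :=
  \row_(l < m) (if (l < p)%N then (k l)%:R / (n l)%:R else x 0 l).
pose w l (j : 'I_(n l).+1) : R[i] := (bw x j)%:C.
pose T p := \sum_(k : index) h (pt p k) * weight w k.
have w1 l : \sum_(j < (n l).+1) w l j = 1.
  by rewrite -rmorph_sum /= sum_bw.
have wE k : weight w k = (weight (bw x) k)%:C by rewrite /weight rmorph_prod.
have pt_cube p k : cube (pt p k).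
  by move=> l; rewrite mxE; case: ifP => _; [exact: gridpoint01|exact: cx].
have T0 : T 0%N = h x.
  rewrite /T (eq_bigr (fun k : index => h x * weight w k)).
    by rewrite -mulr_sumr sum_weight ?mulr1.
  move=> k _; congr (h _ * _).
  by apply/rowP => l; rewrite mxE.
have Tm : T m = bernstein n h x.
  rewrite bernsteinE /T; apply: eq_bigr => k _; rewrite wE; congr (h _ * _).
  by apply/rowP => l; rewrite !mxE ltn_ord.
have step (l : 'I_m) : normc (T l.+1 - T l) <= C l.
  (* [pt l k] does not depend on [k l], so averaging [pt l.+1 k] over coordinate [l] first gives the
     one-variable operator at [pt l k]. *)
  rewrite /T (sum_resample (fun k : index => h (pt l.+1 k)) (w1 l)) -sumrB.
  apply: le_trans (normc_sum _ _ _) _.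
  have -> : C l = \sum_(k : index) C l * weight (bw x) k.
    by rewrite -mulr_sumr sum_weight ?mulr1 // => i; exact: sum_bw.
  apply: ler_sum => k _; rewrite -mulrBl normcM wE normc_real.
  rewrite ger0_norm ?weight_ge0 //; apply: ler_wpM2r; first exact: weight_ge0.
  have -> : \sum_(j < (n l).+1) h (pt l.+1 (resample k j)) * w l j =
     bernstein_coord l h (pt l k).
    apply: eq_bigr => j _; congr (h _ * _); last first.
      (* Coordinate [l] of [pt l k] is still that of [x], so the two weights agree. *)
      by rewrite /w /bw mxE ltnn.
    apply/rowP => i; rewrite !mxE; case: eqVneq => [->|il].
      by rewrite ltnSn ffunE dfwith_in.
    by rewrite ltnS leq_eqVlt (inj_eq val_inj) (negbTE il) resample_out.
  exact: hC.
rewrite -Tm -T0 -(@telescope_sumr _ 0 m T) // big_mkord.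
by apply: le_trans (normc_sum _ _ _) _; apply: ler_sum.
Qed.

End Hybrid.

(** * Euclidean norms, moduli of continuity, and the Lipschitz estimates *)

Section Euclidean.
Variables (R : realType) (m : nat).
Implicit Types (a b : 'I_m -> R) (v w : 'rV[R]_m).

(** Taken on families of reals so that [rnorm] (coordinates) and [cnorm] (moduli of coordinates) are
    both instances. *)
Definition l2norm a : R := Num.sqrt (\sum_i a i ^+ 2).

Lemma l2norm_ge0 a : 0 <= l2norm a. Proof. exact: sqrtr_ge0. Qed.

Lemma l2normK a : l2norm a ^+ 2 = \sum_i a i ^+ 2.
Proof. by rewrite sqr_sqrtr // sumr_ge0 // => i _; exact: sqr_ge0. Qed.

(* Lagrange's identity *)
Lemma cauchy_schwarz a b : \sum_i a i * b i <= l2norm a * l2norm b.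
Proof.
set P := \sum_i _.
have PP : P ^+ 2 <= (l2norm a * l2norm b) ^+ 2.
  rewrite exprMn !l2normK -subr_ge0 -(@pmulr_rge0 _ 2%:R) //.
  have <- : \sum_i \sum_j (a i * b j - a j * b i) ^+ 2 =
      2%:R * ((\sum_i a i ^+ 2) * (\sum_i b i ^+ 2) - P ^+ 2).
    rewrite (eq_bigr (fun i => a i ^+ 2 * (\sum_j b j ^+ 2) +
       (b i ^+ 2 * (\sum_j a j ^+ 2) - 2%:R * P * (a i * b i)))); last first.
      move=> i _; rewrite /P !mulr_sumr mulr_suml -sumrN -!big_split /=.
      by apply: eq_bigr => j _; ring.
    rewrite !big_split /= sumrN -!mulr_suml -mulr_sumr -/P; ring.
  by do 2![apply: sumr_ge0 => ? _]; exact: sqr_ge0.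
apply: le_trans (ler_norm _) _.
rewrite -(ger0_norm (mulr_ge0 (l2norm_ge0 a) (l2norm_ge0 b))).
by rewrite -ler_sqr ?nnegrE // !real_normK ?num_real.
Qed.

Lemma le_l2norm a b : (forall i, 0 <= a i <= b i) -> l2norm a <= l2norm b.
Proof.
move=> ab; rewrite ler_wsqrtr //; apply: ler_sum => i _.
by have /andP[a0 ?] := ab i; rewrite ler_sqr // nnegrE (le_trans a0).
Qed.

Lemma l2normD a b : l2norm (fun i => a i + b i) <= l2norm a + l2norm b.
Proof.
rewrite -ler_sqr ?nnegrE ?addr_ge0 ?l2norm_ge0 //.
have -> : (l2norm a + l2norm b) ^+ 2 =
    l2norm a ^+ 2 + 2%:R * (l2norm a * l2norm b) + l2norm b ^+ 2 by ring.
rewrite !l2normK.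
rewrite (eq_bigr (fun i => a i ^+ 2 + 2%:R * (a i * b i) + b i ^+ 2)).
  rewrite !big_split /= lerD2r lerD2l -mulr_sumr ler_wpM2l //.
  exact: cauchy_schwarz.
by move=> i _; ring.
Qed.

Lemma l2norm_le_sum a : (forall i, 0 <= a i) -> l2norm a <= \sum_i a i.
Proof.
move=> a0; have S0 : 0 <= \sum_i a i by apply: sumr_ge0.
rewrite -ler_sqr ?nnegrE ?l2norm_ge0 // l2normK expr2 mulr_suml.
apply: ler_sum => i _; rewrite expr2 ler_wpM2l //.
by rewrite (bigD1 i) //= lerDl sumr_ge0.
Qed.

Lemma rnorm_ge0 v : 0 <= rnorm v. Proof. exact: sqrtr_ge0. Qed.

Lemma sqr_rnorm v : rnorm v ^+ 2 = \sum_l v 0 l ^+ 2.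
Proof. exact: l2normK. Qed.

Lemma rnorm0 : rnorm (0 : 'rV[R]_m) = 0.
Proof. by rewrite /rnorm big1 ?sqrtr0 // => i _; rewrite mxE expr0n. Qed.

Lemma rnormZ c v : rnorm (c *: v) = `|c| * rnorm v.
Proof.
rewrite /rnorm -sqrtr_sqr -sqrtrM ?sqr_ge0 // mulr_sumr.
by congr Num.sqrt; apply: eq_bigr => i _; rewrite mxE exprMn.
Qed.

Lemma rnormD v w : rnorm (v + w) <= rnorm v + rnorm w.
Proof.
rewrite /rnorm; under eq_bigr do rewrite mxE.
exact: (l2normD (v 0) (w 0)).
Qed.

Lemma rnormN v : rnorm (- v) = rnorm v.
Proof. by rewrite -scaleN1r rnormZ normrN1 mul1r. Qed.

Lemma coord_le_rnorm v i : `|v 0 i| <= rnorm v.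
Proof.
rewrite -sqrtr_sqr ler_wsqrtr // (bigD1 i) //= lerDl sumr_ge0 // => j _.
exact: sqr_ge0.
Qed.

Lemma rnorm_le_sum v : rnorm v <= \sum_i `|v 0 i|.
Proof.
apply: le_trans (l2norm_le_sum (fun i => normr_ge0 (v 0 i))).
by rewrite /rnorm; under eq_bigr do rewrite -(real_normK (num_real _)).
Qed.

Lemma cnorm_le_sum (v : 'rV[R[i]]_m) : cnorm v <= \sum_i normc (v 0 i).
Proof. exact: (l2norm_le_sum (fun i => normc_ge0 (v 0 i))). Qed.

Lemma cnorm_ge0 (v : 'rV[R[i]]_m) : 0 <= cnorm v. Proof. exact: sqrtr_ge0. Qed.

Lemma cnorm0 : cnorm (0 : 'rV[R[i]]_m) = 0.
Proof. by rewrite /cnorm big1 ?sqrtr0 // => i _; rewrite mxE normc0 expr0n. Qed.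

Lemma cnormN (v : 'rV[R[i]]_m) : cnorm (- v) = cnorm v.
Proof. by congr Num.sqrt; apply: eq_bigr => i _; rewrite mxE normcN. Qed.

Lemma cnormD (v w : 'rV[R[i]]_m) : cnorm (v + w) <= cnorm v + cnorm w.
Proof.
apply: le_trans (l2normD (fun i => normc (v 0 i)) (fun i => normc (w 0 i))).
by apply: le_l2norm => i; rewrite normc_ge0 mxE le_normcD.
Qed.

(** The real inequality applied to moduli; it serves to pair a complex gradient with a real
    derivative of [phi]. *)
Lemma cnorm_cauchy_schwarz (v : 'rV[R[i]]_m) w :
  normc (\sum_i v 0 i * (w 0 i)%:C) <= cnorm v * rnorm w.
Proof.
have -> : rnorm w = l2norm (fun i => `|w 0 i|).
  by congr Num.sqrt; apply: eq_bigr => i _; rewrite real_normK ?num_real.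
apply: le_trans (cauchy_schwarz (fun i => normc (v 0 i)) _).
apply: le_trans (normc_sum _ _ _) _.
by apply: ler_sum => i _; rewrite normcM normc_real.
Qed.

End Euclidean.

Section Modulus.
Variables (R : realType) (m : nat) (W : zmodType) (N : W -> R).
Hypotheses (N0 : N 0 = 0) (NN : forall a, N (- a) = N a).
Hypothesis (ND : forall a b, N (a + b) <= N a + N b).
Implicit Types (x y : 'rV[R]_m) (g : 'rV[R]_m -> W).

(** The real [sup] of an unbounded set is 0; this condition is what makes [modulus] and [supnorm]
    genuine upper bounds. *)
Definition bounded_on_cube g := exists M, forall x, cube x -> N (g x) <= M.

Lemma modulus_ub g delta x y : bounded_on_cube g -> cube x -> cube y ->
  rnorm (x - y) <= delta -> N (g x - g y) <= modulus N g delta.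
Proof.
move=> [M gM] cx cy xy; apply: ub_le_sup; last by exists x, y.
exists (M + M) => _ [x' [y' [cx' cy' _ ->]]].
by apply: le_trans (ND _ _) _; rewrite NN lerD ?gM.
Qed.

Lemma cube0 : cube (0 : 'rV[R]_m).
Proof. by move=> l; rewrite mxE lexx ler01. Qed.

Lemma modulus_ge0 g delta : bounded_on_cube g -> 0 <= delta ->
  0 <= modulus N g delta.
Proof.
move=> bg d0; have := @modulus_ub g delta 0 0 bg cube0 cube0.
by rewrite !subrr rnorm0 N0 => /(_ d0).
Qed.

Lemma cube_convex x y (t : R) : cube x -> cube y -> 0 <= t <= 1 ->
  cube (x + t *: (y - x)).
Proof.
move=> cx cy /andP[t0 t1] l; rewrite !mxE.
by have /andP[? ?] := cx l; have /andP[? ?] := cy l; apply/andP; split; nra.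
Qed.

(** Cut the segment from [x] to [y] into [p + 1] equal pieces, [p] being the integer part of [lam].
    Each has length at most [delta] since [lam < p + 1], and there are at most [1 + lam] of them. *)
Lemma modulus_scale g lam delta x y : bounded_on_cube g ->
  0 <= lam -> 0 <= delta -> cube x -> cube y -> rnorm (x - y) <= lam * delta ->
  N (g x - g y) <= (1 + lam) * modulus N g delta.
Proof.
move=> bg lam0 d0 cx cy xy.
pose p := Num.truncn lam; have /andP[plam lamp] := truncn_itv lam0.
have p0 : 0 < p.+1%:R :> R by rewrite ltr0n.
pose u (i : nat) : 'rV[R]_m := x + (i%:R / p.+1%:R) *: (y - x).
have cu i : (i <= p.+1)%N -> cube (u i).
  by move=> ip; apply: cube_convex => //; exact: ratio01.
have -> : g x = g (u 0%N) by rewrite /u mul0r scale0r addr0.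
have -> : g y = g (u p.+1) by rewrite /u divff ?gt_eqF // scale1r addrC subrK.
rewrite -NN opprB -(@telescope_sumr _ 0 p.+1 (fun i => g (u i))) //.
apply: (@le_trans _ _ (p.+1%:R * modulus N g delta)); last first.
  rewrite ler_wpM2r ?modulus_ge0 // -natr1 addrC lerD2l //.
have NS (I : Type) (r : seq I) (P : pred I) (F : I -> W) :
    N (\sum_(i <- r | P i) F i) <= \sum_(i <- r | P i) N (F i).
  elim/big_ind2: _ => [|a b c d ab cd|//]; first by rewrite N0.
  exact: le_trans (ND _ _) (lerD ab cd).
rewrite big_mkord; apply: le_trans (NS _ _ _ _) _.
rewrite mulr_natl -[X in _ *+ X]card_ord -sumr_const; apply: ler_sum => i _.
apply: modulus_ub => //; try by apply: cu; rewrite // ltnW.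
rewrite /u opprD addrACA subrr add0r -scalerBl -mulrBl -natr1 addrAC subrr.
rewrite add0r rnormZ mul1r ger0_norm ?invr_ge0 ?ler0n //.
rewrite -rnormN opprB mulrC ler_pdivrMr // mulrC; apply: le_trans xy _.
by rewrite ler_wpM2r // ltW.
Qed.

End Modulus.

Section OneStep.
Variables (R : realType) (m : nat).
Variable phi : 'rV[R]_m -> 'rV[R]_m.
Hypothesis phi_cube : forall x, cube x -> cube (phi x).
Variables (n : 'I_m -> nat) (n_gt0 : forall l, (0 < n l)%N).
Variable g : 'rV[R]_m -> R[i].
Hypothesis bg : bounded_on_cube (@normc R) g.
Local Notation index := {dffun forall l : 'I_m, 'I_(n l).+1}.

Let modC_scale lam delta x y := @modulus_scale _ _ _ _
  (@normc0 R) (@normcN R) (@le_normcD R) g lam delta x y bg.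
Let modC_ge0 delta := @modulus_ge0 _ _ _ _
  (@normc0 R) (@normcN R) (@le_normcD R) g delta bg.

(** With [d] the distance from [x] to the grid point, [modulus_scale] is used with [lam = d / s] and
    [delta = L s]; [m0] ensures [s > 0]. AM-GM bounds [1 + d / s] by [5/4 + d^2 / s^2], and the mean
    of [d^2] is at most [s^2 / 4], whence [5/4 + 1/4 = 3/2]. *)
Lemma one_step_full L x : (0 < m)%N -> lipschitz_const phi L -> cube x ->
  normc (bernstein n (koopman phi g) x - koopman phi g x)
  <= 3%:R / 2%:R * modulus (@normc R) g (L * Num.sqrt (\sum_(l < m) (n l)%:R^-1)).
Proof.
move=> m0 [L0 Llip] cx; set s2 := \sum_(l < m) _; set s := Num.sqrt s2.
have inv0 l : 0 < (n l)%:R^-1 :> R by rewrite invr_gt0 ltr0n.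
have s20 : 0 < s2.
  rewrite /s2 (bigD1 (Ordinal m0)) //=; apply: ltr_pwDl; first exact: inv0.
  by apply: sumr_ge0 => l _; exact: ltW.
have s0 : 0 < s by rewrite sqrtr_gt0.
have sE : s ^+ 2 = s2 by rewrite sqr_sqrtr // ltW.
have Ls0 : 0 <= L * s by rewrite mulr_ge0 // ltW.
set Om := modulus _ _ _; have Om0 : 0 <= Om by exact: modC_ge0.
pose y (k : index) : 'rV[R]_m := \row_l ((k l)%:R / (n l)%:R).
have cy k : cube (y k) by move=> l; rewrite mxE; exact: gridpoint01.
have W1 := sum_weight (@sum_bw R m n x).
have -> : bernstein n (koopman phi g) x - koopman phi g x =
    \sum_(k : index) (g (phi (y k)) - g (phi x)) * (weight (bw x) k)%:C.
  under [RHS]eq_bigr do rewrite mulrBl.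
  by rewrite sumrB -mulr_sumr -rmorph_sum /= W1 mulr1.
apply: le_trans (normc_sum _ _ _) _.
(* AM-GM: [d / s <= d^2 / s^2 + 1/4] *)
have term k : normc ((g (phi (y k)) - g (phi x)) * (weight (bw x) k)%:C) <=
   Om * ((5%:R / 4%:R) * weight (bw x) k
         + s ^- 2 * (\sum_l (y k 0 l - x 0 l) ^+ 2 * weight (bw x) k)).
  have w0 : 0 <= weight (bw x) k by exact: weight_ge0.
  rewrite normcM normc_real ger0_norm //.
  rewrite -mulr_suml mulrA -mulrDl mulrA ler_wpM2r //.
  pose d := rnorm (y k - x).
  have d0 : 0 <= d by exact: rnorm_ge0.
  have dE : d ^+ 2 = \sum_l (y k 0 l - x 0 l) ^+ 2.
    by rewrite sqr_rnorm; apply: eq_bigr => l _; rewrite !mxE.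
  apply: le_trans (modC_scale (lam := d / s) (delta := L * s) _ _ _ _ _) _ => //.
  - by rewrite divr_ge0 // ltW.
  - exact: phi_cube.
  - exact: phi_cube.
  - rewrite mulrCA mulfVK ?gt_eqF //; exact: Llip.
  rewrite -/Om mulrC ler_wpM2l // -dE.
  rewrite -subr_ge0.
  have -> : 5%:R / 4%:R + s ^- 2 * d ^+ 2 - (1 + d / s) = (d / s - 2^-1) ^+ 2.
    by field; rewrite gt_eqF.
  exact: sqr_ge0.
apply: le_trans (ler_sum _ (fun k _ => term k)) _.
rewrite -mulr_sumr big_split /= -!mulr_sumr W1 exchange_big /=.
rewrite mulrC ler_wpM2r //.
(* The mean squared distance is the sum of the coordinate variances, each computed on its binomial
   marginal. *)
have : \sum_l \sum_(k : index) (y k 0 l - x 0 l) ^+ 2 * weight (bw x) k <= s2 / 4%:R.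
  rewrite /s2 mulr_suml; apply: ler_sum => l _.
  under eq_bigr do rewrite mxE.
  rewrite (sum_marginal (w := bw x) _
     (fun j : 'I_(n l).+1 => (j%:R / (n l)%:R - x 0 l) ^+ 2)); last exact: sum_bw.
  under eq_bigr do rewrite mulrC.
  by apply: le_trans (bernstein_variance _ (n_gt0 l)) _; rewrite invfM mulrC.
have is0 : 0 <= s ^- 2 by rewrite invr_ge0 exprn_ge0 // ltW.
move=> /(ler_wpM2l is0) /(lerD (lexx (5%:R / 4%:R * 1))) /le_trans -> //.
rewrite -sE le_eqVlt; apply/orP; left; apply/eqP.
by field; rewrite gt_eqF.
Qed.

(** In one variable, [lam = d s] and [delta = L l / s] with [s = sqrt (n l)]. The mean of [d] is at
    most [1 / (2 s)], so that of [1 + d s] is at most [3/2]. *)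
Lemma one_step_partial (L : 'I_m -> R) x :
  (forall l, partial_lipschitz_const l phi (L l)) -> cube x ->
  normc (bernstein n (koopman phi g) x - koopman phi g x)
  <= 3%:R / 2%:R * \sum_(l < m) modulus (@normc R) g (L l / Num.sqrt (n l)%:R).
Proof.
move=> Llip cx; rewrite mulr_sumr; apply: bernstein_error => // l {cx}x cx.
have [L0 Ll] := Llip l; set s := Num.sqrt _.
have s0 : 0 < s by rewrite sqrtr_gt0 ltr0n.
have Ls0 : 0 <= L l / s by rewrite divr_ge0 // ltW.
set Om := modulus _ _ _; have Om0 : 0 <= Om by exact: modC_ge0.
have xl : 0 <= x 0 l <= 1 by exact: cx.
pose y (j : 'I_(n l).+1) := upd x l (j%:R / (n l)%:R).
have cy j : cube (y j) by apply: upd_cube => //; exact: gridpoint01.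
have W1 := sum_bw n x l.
have -> : bernstein_coord n l (koopman phi g) x - koopman phi g x =
    \sum_(j < (n l).+1) (g (phi (y j)) - g (phi x)) * (bw x j)%:C.
  under [RHS]eq_bigr do rewrite mulrBl.
  by rewrite sumrB -mulr_sumr -rmorph_sum /= W1 mulr1.
apply: le_trans (normc_sum _ _ _) _.
apply: (@le_trans _ _ (\sum_(j < (n l).+1)
   (Om * bw x j + Om * s * (bw x j * `|j%:R / (n l)%:R - x 0 l|)))).
  apply: ler_sum => j _; have w0 : 0 <= bw x j by exact: bw_ge0.
  rewrite normcM normc_real ger0_norm //.
  set d := `|_|.
  have -> : Om * bw x j + Om * s * (bw x j * d) = (1 + d * s) * Om * bw x j.
    ring.
  rewrite ler_wpM2r //.
  apply: (modC_scale (lam := d * s) (delta := L l / s)) => //.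
  - by rewrite mulr_ge0 ?normr_ge0 ?ltW.
  - exact: phi_cube.
  - exact: phi_cube.
  - apply: le_trans (Ll _ _ (cy j) cx _) _.
      by move=> i il; rewrite upd_out.
    by rewrite upd_in -/d mulrCA mulfK ?gt_eqF.
rewrite big_split /= -!mulr_sumr W1 mulr1.
have := bernstein_abs (n_gt0 l) xl.
move=> /(ler_wpM2l (mulr_ge0 Om0 (ltW s0))) /(lerD (lexx Om)) /le_trans -> //.
rewrite -/s le_eqVlt; apply/orP; left; apply/eqP.
by field; rewrite gt_eqF.
Qed.

End OneStep.

(** * Differential calculus on the cube *)

Section ComplexCalculus.
Variable R : realType.

(** Radii for [R[i]^o] are themselves complex, but a positive complex number has zero imaginary
    part, so real radii suffice. *)
Lemma cvg_normcP {T : Type} (F : set_system T) {FF : Filter F}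
    (f : T -> R[i]^o) (l : R[i]^o) :
  f @ F --> l <-> forall e : R, 0 < e -> \forall t \near F, normc (l - f t) < e.
Proof.
rewrite cvgrPdist_lt; split => [fl e e0|fl].
  have /fl : 0 < e%:C by rewrite ltcR.
  by apply: filterS => t; rewrite -ltcR.
case=> e e' /=; rewrite ltcE /= => /andP[/eqP -> e0].
have := fl e e0; apply: filterS => t.
by rewrite -ltcR.
Qed.

(** For complex values there is no mean value equality, so the inequality is proved by continuous
    induction on [G t = F t - t c], with slope [M + e] in place of [M]. The derivative is only taken
    within [[0, 1]], hence one-sided at the ends. *)
Lemma mean_value (F : R -> R[i]) (a b M : R) (c : R[i]) :
  0 <= a <= 1 -> 0 <= b <= 1 ->
  (forall s, (a <= s <= b) || (b <= s <= a) -> exists2 d,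
     normc (d - c) <= M &
     forall e, 0 < e -> \forall t \near s, 0 <= t <= 1 ->
       normc (F t - F s - (t - s)%:C * d) <= e * `|t - s|) ->
  normc (F b - F a - (b - a)%:C * c) <= M * `|b - a|.
Proof.
wlog ab : a b / a <= b.
  move=> H; have [/H//|/ltW /H ba] := leP a b.
  move=> a01 b01 Fd; rewrite -normcN distrC.
  have -> : - (F b - F a - (b - a)%:C * c) = F a - F b - (a - b)%:C * c.
    by rewrite -[b - a]opprB rmorphN /=; ring.
  by apply: ba => // s; rewrite orbC; exact: Fd.
move=> /andP[a0 a1] /andP[b0 b1] Fd.
apply/ler_addgt0Pr => e e0.
(* The extra slope costs [e (b - a)], at most [e] because [b - a <= 1]. *)
apply: (@le_trans _ _ ((M + e) * (b - a))); last first.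
  rewrite ger0_norm ?subr_ge0 // mulrDl lerD2l ler_piMr ?(ltW e0) //.
  by rewrite lerBlDr (le_trans b1) // lerDl.
set K := M + e; pose G t := F t - t%:C * c.
have loc s : a <= s <= b -> exists2 r, 0 < r & forall t, a <= t <= b ->
    `|s - t| < r -> normc (G t - G s) <= K * `|t - s|.
  move=> sab; have [|d dM /(_ _ e0)] := Fd s; first by rewrite sab.
  move=> /nbhs_ballP[r /= r0 H]; exists r => // t /andP[ta tb] ts.
  have t01 : 0 <= t <= 1 by rewrite (le_trans a0) // (le_trans tb).
  have -> : G t - G s = (F t - F s - (t - s)%:C * d) + (t - s)%:C * (d - c).
    by rewrite /G rmorphB /=; ring.
  apply: le_trans (le_normcD _ _) _; rewrite normcM normc_real /K addrC mulrDl.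
  by rewrite [_ * normc _]mulrC lerD ?ler_wpM2r ?normr_ge0 //; apply: H.
(* The supremum of [S] is attained and equals [b]. *)
pose S := [set t | a <= t <= b /\ normc (G t - G a) <= K * (t - a)].
have Sa : S a by split; rewrite ?lexx ?ab // !subrr normc0 mulr0.
have Sb : ubound S b by move=> t [/andP[]].
have supS : has_sup S by split; [exists a|exists b].
have K0 : 0 <= K.
  have [|d dM _] := Fd a; first by rewrite lexx ab.
  by apply: addr_ge0; [exact: le_trans (normc_ge0 _) dM|exact: ltW].
have cab : a <= sup S <= b.
  apply/andP; split; first by apply: ub_le_sup => //; exists b.
  by apply: ge_sup => //; exists a.
have [r r0 H] := loc _ cab; set t0 := sup S in cab H *.
(* Go from [a] to a point of [S] within [r] of [t0], then to [t0] by the local estimate there. *)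
have St0 : normc (G t0 - G a) <= K * (t0 - a).
  have [t [tab Gt]] := sup_adherent r0 supS; rewrite -/t0 => tr.
  have tt0 : t <= t0 by apply: ub_le_sup; [exists b|].
  have -> : G t0 - G a = - (G t - G t0) + (G t - G a) by ring.
  apply: le_trans (le_normcD _ _) _; rewrite normcN.
  have -> : K * (t0 - a) = K * (t0 - t) + K * (t - a) by ring.
  apply: lerD => //; apply: le_trans (H t tab _) _.
    by rewrite ger0_norm ?subr_ge0 // ltrBlDr addrC -ltrBlDr.
  by rewrite distrC ger0_norm ?subr_ge0.
(* If [t0 < b], the local estimate at [t0] puts a larger [t] in [S]; the half radius keeps
   [t - t0 < r]. *)
have t0b : t0 = b.
  apply/eqP; rewrite eq_le; have /andP[at0 ->] := cab; rewrite leNgt /=.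
  apply/negP => t0b; pose t := Num.min b (t0 + r / 2%:R).
  have t0t : t0 < t by rewrite lt_min t0b ltrDl divr_gt0.
  have tb : t <= b by rewrite ge_min lexx.
  have tab : a <= t <= b by rewrite tb (le_trans at0) // ltW.
  have tr : t - t0 < r.
    rewrite ltrBlDl (@le_lt_trans _ _ (t0 + r / 2%:R)) //.
      by rewrite ge_min lexx orbT.
    rewrite ltrD2l; lra.
  suff St : S t.
    have : t <= t0 by apply: ub_le_sup => //; exists b.
    by rewrite leNgt t0t.
  split=> //; have -> : G t - G a = (G t - G t0) + (G t0 - G a) by ring.
  apply: le_trans (le_normcD _ _) _.
  have -> : K * (t - a) = K * (t - t0) + K * (t0 - a) by ring.
  apply: lerD => //; apply: le_trans (H t tab _) _.
    by rewrite distrC ger0_norm ?subr_ge0 ?(ltW t0t).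
  by rewrite ger0_norm ?subr_ge0 ?(ltW t0t).
have -> : F b - F a - (b - a)%:C * c = G t0 - G a.
  by rewrite t0b /G rmorphB /=; ring.
by rewrite -t0b.
Qed.

End ComplexCalculus.

Section CubeCalculus.
Variables (R : realType) (m : nat).
Implicit Types (x y u v : 'rV[R]_m) (g : 'rV[R]_m -> R[i]).

Lemma cubeE : @cube R m =
  [set v : 'rV[R]_m | forall i, `[0, 1]%classic (v ord0 i)].
Proof.
by apply/seteqP; split=> v cv i; have := cv i; rewrite /= in_itv.
Qed.

Lemma cube_compact : compact (@cube R m).
Proof.
rewrite cubeE.
exact: (@rV_compact R m (fun=> `[0, 1]%classic) (fun=> @segment_compact R 0 1)).
Qed.

Lemma continuous_on_cubeP g : continuous_on_cube g <->
  forall x, cube x -> forall e, 0 < e ->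
    \forall y \near x, cube y -> normc (g x - g y) < e.
Proof.
rewrite /continuous_on_cube subspace_continuousP; split => gc x cx.
  by move=> e e0; have /cvg_normcP/(_ e e0) := gc x cx.
by apply/cvg_normcP => e e0; exact: gc.
Qed.

Lemma continuous_bounded g : continuous_on_cube g ->
  bounded_on_cube (@normc R) g.
Proof.
move=> /continuous_on_cubeP gc.
have ng : {within cube, continuous (fun x => normc (g x))}.
  apply/subspace_continuousP => x cx; apply/cvgrPdist_lt => e e0.
  have := gc x cx e e0; apply: filterS => y H /H.
  (* Reverse triangle inequality, taken in [Rcomplex R], where the norm is real-valued. *)
  by apply: le_lt_trans; exact: (@ler_dist_dist R (Rcomplex R)).
have c0 : @cube R m !=set0 by exists (0 : 'rV[R]_m); exact: cube0.
have [x _ xM] := EVT_max_rV c0 cube_compact ng.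
by exists (normc (g x)) => y cy; apply: xM; rewrite inE.
Qed.

Lemma shiftE x l t : x + t *: delta_mx 0 l = upd x l (x 0 l + t).
Proof.
apply/rowP => i; rewrite !mxE eqxx /=.
by case: eqP => [->|_]; rewrite ?mulr1 ?mulr0 ?addr0.
Qed.

(** Step up if [x 0 l <= 1/2] and down otherwise: a step of at most [1/2] stays in the cube. Hence
    [increment l x] is proper and its limits are unique. *)
Lemma increment_neq0 x l (r : R) : cube x -> 0 < r ->
  exists t, [/\ t != 0, `|t| < r & cube (x + t *: delta_mx 0 l)].
Proof.
move=> cx r0; have /andP[x0 x1] := cx l.
pose t := Num.min (r / 2%:R) (2%:R^-1).
have t0 : 0 < t by rewrite lt_min; apply/andP; split; lra.
have tr : t < r.
  rewrite (@le_lt_trans _ _ (r / 2%:R)) ?ge_min ?lexx //; lra.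
have t2 : t <= 2%:R^-1 by rewrite ge_min lexx orbT.
have [xl|xl] := leP (x 0 l) 2%:R^-1.
  exists t; rewrite gt_eqF // gtr0_norm //; split=> //.
  rewrite shiftE; apply: upd_cube => //; lra.
exists (- t); rewrite oppr_eq0 gt_eqF // normrN gtr0_norm //; split=> //.
rewrite shiftE; apply: upd_cube => //; lra.
Qed.

Lemma increment_proper x l : cube x -> ProperFilter (increment l x).
Proof.
move=> cx; apply: Build_ProperFilter_ex => A.
rewrite /increment /within /= => /nbhs_ballP[r /= r0 H].
have [t [t0 tr ct]] := increment_neq0 l cx r0.
exists t; apply: H => //; by rewrite /ball /= sub0r normrN.
Qed.

(** A first-order expansion instead of a quotient: no division, [t = 0] included, as [mean_value]
    expects. *)
Definition partial_at g l x (d : R[i]) := forall e, 0 < e ->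
  \forall t \near (0 : R), cube (x + t *: delta_mx 0 l) ->
    normc (g (x + t *: delta_mx 0 l) - g x - t%:C * d) <= e * `|t|.

Lemma cquot_partial_at g l x (d : R[i]) :
  (cquot g l x t @[t --> increment l x] --> (d : R[i]^o)) -> partial_at g l x d.
Proof.
move=> /cvg_normcP gd e e0.
have : \forall t \near (0 : R), t != 0 -> cube (x + t *: delta_mx 0 l) ->
  normc (d - cquot g l x t) < e := gd e e0.
apply: filterS => t H ct.
have [->|t0] := eqVneq t 0.
  by rewrite scale0r addr0 subrr sub0r mul0r oppr0 normc0 normr0 mulr0.
have tC0 : t%:C != 0 by rewrite eq_complex /= negb_and t0.
have -> : g (x + t *: delta_mx 0 l) - g x - t%:C * d =
   - (t%:C * (d - cquot g l x t)).
  by rewrite /cquot mulrBr mulrCA divff // mulr1 opprB.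
rewrite normcN normcM normc_real mulrC ler_wpM2r ?normr_ge0 //.
exact/ltW/H.
Qed.

(** Stated by coordinates, which avoids passing between the max norm of the library and the
    Euclidean one. *)
Definition vpartial_at (phi : 'rV[R]_m -> 'rV[R]_m) l x (d : 'rV[R]_m) :=
  forall i e, 0 < e -> \forall t \near (0 : R), cube (x + t *: delta_mx 0 l) ->
    `|phi (x + t *: delta_mx 0 l) 0 i - phi x 0 i - t * d 0 i| <= e * `|t|.

Lemma vquot_vpartial_at phi l x (d : 'rV[R]_m) :
  (vquot phi l x t @[t --> increment l x] --> d) -> vpartial_at phi l x d.
Proof.
move=> phid i e e0.
have : (fun t => vquot phi l x t 0 i) @ increment l x --> d 0 i.
  apply: (@cvg_comp _ _ _ (vquot phi l x) (fun v : 'rV[R]_m => v 0 i) _ _ _ phid).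
  exact: coord_continuous.
move=> /cvgrPdist_lt /(_ e e0) phie.
have : \forall t \near (0 : R), t != 0 -> cube (x + t *: delta_mx 0 l) ->
  `|d 0 i - vquot phi l x t 0 i| < e := phie.
apply: filterS => t H ct.
have [->|t0] := eqVneq t 0.
  by rewrite scale0r addr0 subrr sub0r mul0r oppr0 normr0 mulr0.
have -> : phi (x + t *: delta_mx 0 l) 0 i - phi x 0 i - t * d 0 i =
   - (t * (d 0 i - vquot phi l x t 0 i)).
  by rewrite /vquot !mxE mulrBr mulrA divff // mul1r opprB.
rewrite normrN normrM mulrC ler_wpM2r ?normr_ge0 //.
exact/ltW/H.
Qed.

(** Some arbitrarily small nonzero step stays in the cube, where the increment of [phi] is at most
    [L |t|]. The tolerance [e / (m + 1)] per coordinate keeps the total expansion error below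
    [e |t|]. *)
Lemma rnorm_vpartial_at phi l x d L : cube x ->
  partial_lipschitz_const l phi L -> vpartial_at phi l x d -> rnorm d <= L.
Proof.
move=> cx [L0 Llip] phid; apply/ler_addgt0Pr => e e0.
have m0 : 0 < m.+1%:R :> R by rewrite ltr0n.
pose e' := e / m.+1%:R; have e'0 : 0 < e' by rewrite divr_gt0.
have /nbhs_ballP[r /= r0 H] :=
  filter_forall (nbhs_filter (0 : R)) (fun i => phid i e' e'0).
have [t [t0 tr ct]] := increment_neq0 l cx r0.
have bt : ball (0 : R) r t by rewrite /ball /= sub0r normrN.
have {}H i := H t bt i ct.
rewrite -(ler_pM2r (x := `|t|)) ?normr_gt0 // mulrC -rnormZ.
set y := x + _ in ct H *.
have -> : t *: d = (phi y - phi x) + (t *: d - (phi y - phi x)).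
  by rewrite addrC subrK.
apply: le_trans (rnormD _ _) _; rewrite mulrDl; apply: lerD.
  apply: le_trans (Llip _ _ ct cx _) _.
    by move=> i il; rewrite /y shiftE upd_out.
  by rewrite /y shiftE upd_in addrAC subrr add0r.
apply: le_trans (rnorm_le_sum _) _.
apply: (@le_trans _ _ (\sum_(i < m) e' * `|t|)).
  by apply: ler_sum => i _; rewrite !mxE distrC; exact: H.
rewrite sumr_const card_ord -mulr_natr mulrAC ler_wpM2r //.
rewrite /e' -mulrA ler_piMr ?(ltW e0) // mulrC ler_pdivrMr // mul1r ler_nat //.
Qed.

End CubeCalculus.

(** * The C^1 estimate *)

Section C1.
Variables (R : realType) (m : nat).
Implicit Types (x y u v : 'rV[R]_m) (f g : 'rV[R]_m -> R[i]).

Lemma partial_at_upd g l z s (d : R[i]) e : 0 < e ->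
  cube z -> partial_at g l (upd z l s) d ->
  \forall t \near s, 0 <= t <= 1 ->
    normc (g (upd z l t) - g (upd z l s) - (t - s)%:C * d) <= e * `|t - s|.
Proof.
move=> e0 cz /(_ e e0) /nbhs_ballP[r /= r0 H].
apply/nbhs_ballP; exists r => // t st t01.
have bt : ball (0 : R) r (t - s) by rewrite /ball /= sub0r opprB.
have := H _ bt; rewrite shiftE upd_in addrC subrK.
have -> : upd (upd z l s) l t = upd z l t.
  by apply/rowP => i; rewrite !mxE; case: eqP.
by apply; exact: upd_cube.
Qed.

(** Continuous partial derivatives give a total differential: go from [u] to [v] along edges
    parallel to the axes, which stay in the cube, and apply the mean value inequality on each edge
    with [c = D i u]. *)
Lemma total_diff g (D : 'I_m -> 'rV[R]_m -> R[i]) u e :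
  (forall i x, cube x -> partial_at g i x (D i x)) ->
  (forall i, continuous_on_cube (D i)) -> cube u -> 0 < e ->
  exists2 r, 0 < r & forall v, cube v -> (forall i, `|v 0 i - u 0 i| < r) ->
    normc (g v - g u - \sum_i (v 0 i - u 0 i)%:C * D i u)
    <= e * \sum_i `|v 0 i - u 0 i|.
Proof.
move=> gD Dc cu e0.
have De i := (continuous_on_cubeP (D i)).1 (Dc i) u cu e e0.
have /nbhs_ballP[r /= r0 H] := filter_forall (nbhs_filter u) De.
exists r => // v cv uv.
have {}H i w : cube w -> (forall j, `|w 0 j - u 0 j| < r) ->
    normc (D i u - D i w) < e.
  move=> cw uw; apply: H => //; split=> // a b; rewrite [a]ord1.
  by rewrite /ball /= distrC.
pose z (p : nat) : 'rV[R]_m := \row_(i < m) (if (i < p)%N then v 0 i else u 0 i).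
have cz p : cube (z p) by move=> i; rewrite mxE; case: ifP.
have zm : z m = v by apply/rowP => i; rewrite mxE ltn_ord.
have z0 : z 0%N = u by apply/rowP => i; rewrite mxE.
have step (i : 'I_m) : normc (g (z i.+1) - g (z i) - (v 0 i - u 0 i)%:C * D i u)
    <= e * `|v 0 i - u 0 i|.
  have -> : z i.+1 = upd (z i) i (v 0 i).
    apply/rowP => j; rewrite !mxE ltnS leq_eqVlt (inj_eq val_inj).
    by case: eqVneq => [->|].
  have -> : z i = upd (z i) i (u 0 i).
    apply/rowP => j; rewrite !mxE.
    by case: eqVneq => [->|//]; rewrite ltnn.
  have -> : upd (upd (z i) i (u 0 i)) i (v 0 i) = upd (z i) i (v 0 i).
    by apply/rowP => j; rewrite !mxE; case: eqP.
  apply: (mean_value (F := fun t => g (upd (z i) i t))); [exact: cu|exact: cv|].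
  move=> s sb; have s01 : 0 <= s <= 1.
    have /andP[u0 u1] := cu i; have /andP[v0 v1] := cv i.
    by case/orP: sb => /andP[? ?]; apply/andP; split; lra.
  have cs : cube (upd (z i) i s) by exact: upd_cube.
  exists (D i (upd (z i) i s)); last first.
    by move=> e' e'0; apply: partial_at_upd => //; exact: gD.
  (* Points of the edge stay in the [r]-box about [u]: coordinate [i] lies between those of [u] and
     [v], the others come from [u] or [v]. *)
  rewrite -normcN opprB; apply/ltW/H => // j; rewrite !mxE.
  case: eqVneq => [->|_]; last by case: ifP => // _; rewrite subrr normr0.
  apply: le_lt_trans (uv i); case/orP: sb => /andP[us sv].
    by rewrite !ger0_norm ?subr_ge0 ?(le_trans us) // lerB.
  by rewrite !ler0_norm ?subr_le0 ?(le_trans us) // lerN2 lerB.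
have -> : g v - g u = \sum_(i < m) (g (z i.+1) - g (z i)).
  by rewrite -zm -z0 -(big_mkord xpredT (fun i => g (z i.+1) - g (z i)))
    (telescope_sumr (fun p => g (z p))).
rewrite -sumrB mulr_sumr; apply: le_trans (normc_sum _ _ _) _.
exact: ler_sum.
Qed.

(** Chain rule. A step along one axis moves [phi] in every coordinate, so the total differential of
    [g] at [phi x] is used; the errors from expanding [g] and [phi] each get half of [e]. *)
Lemma partial_at_comp phi g (D : 'I_m -> 'rV[R]_m -> R[i]) l x d L :
  (forall x, cube x -> cube (phi x)) ->
  (forall i x, cube x -> partial_at g i x (D i x)) ->
  (forall i, continuous_on_cube (D i)) -> cube x ->
  partial_lipschitz_const l phi L -> vpartial_at phi l x d ->
  partial_at (koopman phi g) l x (\sum_i D i (phi x) * (d 0 i)%:C).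
Proof.
move=> phi_cube gD Dc cx [L0 Llip] phid e e0.
have m0 : 0 < m.+1%:R :> R by rewrite ltr0n.
have K0 : 0 < m.+1%:R * (L + 1) by rewrite mulr_gt0 // ltr_wpDl.
(* The coordinate increments of [phi] sum to at most [m L |t|]; the added ones keep the denominator
   positive. *)
pose e1 := e / 2%:R / (m.+1%:R * (L + 1)).
have e10 : 0 < e1 by rewrite !divr_gt0.
pose N := 1 + \sum_i normc (D i (phi x)).
have S0 : 0 <= \sum_i normc (D i (phi x)).
  by apply: sumr_ge0 => i _; exact: normc_ge0.
have N0 : 0 < N by rewrite ltr_pwDl.
(* The expansion errors of [phi] are weighted by the partial derivatives of [g], whose moduli sum to
   less than [N]. *)
pose e2 := e / 2%:R / N; have e20 : 0 < e2 by rewrite !divr_gt0.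
have [r r0 H] := total_diff gD Dc (phi_cube _ cx) e10.
have /nbhs_ballP[r' /= r'0 H'] :=
  filter_forall (nbhs_filter (0 : R)) (fun i => phid i e2 e20).
apply/nbhs_ballP; exists (Num.min r' (r / (L + 1))) => /=.
  by rewrite lt_min r'0 divr_gt0 // ltr_wpDl.
move=> t; rewrite /ball /= sub0r normrN lt_min => /andP[tr' tr] ct.
have bt : ball (0 : R) r' t by rewrite /ball /= sub0r normrN.
have {}H' i := H' t bt i ct; rewrite /koopman /=.
set y := x + _ in ct H' *.
have lip i : `|phi y 0 i - phi x 0 i| <= L * `|t|.
  have := coord_le_rnorm (phi y - phi x) i; rewrite !mxE => /le_trans; apply.
  apply: le_trans (Llip _ _ ct cx _) _.
    by move=> j jl; rewrite /y shiftE upd_out.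
  by rewrite /y shiftE upd_in addrAC subrr add0r.
have Lt : L * `|t| < r.
  rewrite ltr_pdivlMr ?ltr_wpDl // in tr; apply: le_lt_trans tr.
  by rewrite mulrC ler_wpM2l // lerDl.
have {}H := H _ (phi_cube _ ct) (fun i => le_lt_trans (lip i) Lt).
have -> : g (phi y) - g (phi x) - t%:C * \sum_i D i (phi x) * (d 0 i)%:C =
   (g (phi y) - g (phi x) - \sum_i (phi y 0 i - phi x 0 i)%:C * D i (phi x))
   + \sum_i D i (phi x) * (phi y 0 i - phi x 0 i - t * d 0 i)%:C.
  have -> : \sum_i D i (phi x) * (phi y 0 i - phi x 0 i - t * d 0 i)%:C =
    \sum_i (phi y 0 i - phi x 0 i)%:C * D i (phi x)
      - t%:C * \sum_i D i (phi x) * (d 0 i)%:C.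
    rewrite mulr_sumr -sumrB; apply: eq_bigr => i _.
    by rewrite !rmorphB rmorphM /=; ring.
  by rewrite addrA subrK.
apply: le_trans (le_normcD _ _) _.
have -> : e * `|t| = e / 2%:R * `|t| + e / 2%:R * `|t|.
  by rewrite -mulrDl -splitr.
apply: lerD.
  apply: le_trans H _.
  apply: (@le_trans _ _ (e1 * (m.+1%:R * (L + 1) * `|t|))); last first.
    by rewrite mulrA /e1 mulfVK // gt_eqF.
  rewrite ler_wpM2l ?(ltW e10) //.
  apply: (@le_trans _ _ (\sum_(i < m) L * `|t|)); first by apply: ler_sum.
  rewrite sumr_const card_ord -[leLHS]mulr_natl mulrA ler_wpM2r //.
  by rewrite ler_pM ?ler0n ?ler_nat // lerDl.
apply: (@le_trans _ _ (N * (e2 * `|t|))); last first.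
  by rewrite mulrA [N * _]mulrC /e2 mulfVK // gt_eqF.
apply: (@le_trans _ _ (\sum_i normc (D i (phi x)) * (e2 * `|t|))).
  apply: le_trans (normc_sum _ _ _) _; apply: ler_sum => i _.
  by rewrite normcM normc_real ler_wpM2l ?normc_ge0.
rewrite -mulr_suml ler_wpM2r ?lerDr //.
by rewrite mulr_ge0 // ltW.
Qed.

End C1.

Section OneStepC1.
Variables (R : realType) (m : nat).
Variable phi : 'rV[R]_m -> 'rV[R]_m.
Hypothesis phi_cube : forall x, cube x -> cube (phi x).
Variables (n : 'I_m -> nat) (n_gt0 : forall l, (0 < n l)%N).
Variables L Ld : 'I_m -> R.
Hypothesis Llip : forall l, partial_lipschitz_const l phi (L l).
Hypothesis phi_diff : forall l, vpartial_exists phi l.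
Hypothesis Ldlip : forall l, partial_lipschitz_const l (vpartial phi l) (Ld l).
Variable g : 'rV[R]_m -> R[i].
Hypothesis gC1 : C1_on_cube g.

Let gD i x : cube x -> partial_at g i x (cpartial g i x).
Proof. by move=> cx; apply: cquot_partial_at; have [/(_ x cx)] := gC1.2 i. Qed.

Let gDc i : continuous_on_cube (cpartial g i).
Proof. by have [] := gC1.2 i. Qed.

Lemma grad_bounded : bounded_on_cube (@cnorm R m) (grad g).
Proof.
have [M HM] := fin_all_exists (fun i => continuous_bounded (@gDc i)).
exists (\sum_i M i) => x cx; apply: le_trans (cnorm_le_sum _) _.
by apply: ler_sum => i _; rewrite mxE; exact: HM.
Qed.

(** The mean value inequality with [c = dh x] leaves a remainder with one part linear and one
    quadratic in [|r j - x 0 l|], averaged by [bernstein_abs] and [bernstein_variance]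
    respectively. *)
Lemma one_step_C1 x : cube x ->
  normc (bernstein n (koopman phi g) x - koopman phi g x)
  <= \sum_(l < m) (Num.sqrt (n l)%:R)^-1 *
         (L l * modulus (@cnorm R m) (grad g) (L l / (2%:R * Num.sqrt (n l)%:R))
          + supnorm (@cnorm R m) (grad g) * (Ld l / (2%:R * Num.sqrt (n l)%:R))).
Proof.
move=> cx; apply: bernstein_error => // l {cx}x cx.
have [L0 Ll] := Llip l; have [Ld0 Ldl] := Ldlip l.
have nE : (n l)%:R = Num.sqrt (n l)%:R ^+ 2 :> R by rewrite sqr_sqrtr // ler0n.
set s := Num.sqrt _ in nE *.
have s0 : 0 < s by rewrite sqrtr_gt0 ltr0n.
have Ls0 : 0 <= L l / (2%:R * s) by rewrite divr_ge0 // mulr_ge0 // ltW.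
have Om0 := modulus_ge0 (@cnorm0 R m) (@cnormN R m) (@cnormD R m) grad_bounded Ls0.
set Om := modulus _ _ _ in Om0 *; set G := supnorm _ _.
have GM u : cube u -> cnorm (grad g u) <= G.
  move=> cu; apply: ub_le_sup; last by exists u.
  by have [M HM] := grad_bounded; exists M => _ [v cv <-]; exact: HM.
have G0 : 0 <= G by apply: le_trans (GM _ cx); exact: cnorm_ge0.
have xl : 0 <= x 0 l <= 1 by exact: cx.
pose dphi := vpartial phi l; pose h := koopman phi g.
pose dh z := \sum_i cpartial g i (phi z) * (dphi z 0 i)%:C.
have phid z : cube z -> vpartial_at phi l z (dphi z).
  by move=> cz; apply: vquot_vpartial_at; exact: phi_diff.
have hd z : cube z -> partial_at h l z (dh z).
  by move=> cz; apply: partial_at_comp (Llip l) (phid _ cz).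
pose r (j : 'I_(n l).+1) : R := j%:R / (n l)%:R.
pose y (j : 'I_(n l).+1) := upd x l (r j).
have r01 j : 0 <= r j <= 1 by exact: gridpoint01.
have term j : normc (h (y j) - h x - (r j - x 0 l)%:C * dh x) <=
   (L l * ((1 + 2%:R * s * `|r j - x 0 l|) * Om) + G * (Ld l * `|r j - x 0 l|))
    * `|r j - x 0 l|.
  have hx : h x = h (upd x l (x 0 l)) by rewrite upd_id.
  rewrite hx; apply: (mean_value (F := fun t => h (upd x l t))) => //.
  move=> t tb; have t01 : 0 <= t <= 1.
    move: xl (r01 j) => /andP[? ?] /andP[? ?].
    by case/orP: tb => /andP[? ?]; apply/andP; split; lra.
  have ct : cube (upd x l t) by exact: upd_cube.
  exists (dh (upd x l t)); last first.
    by move=> e e0; apply: partial_at_upd => //; exact: hd.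
  have tr : `|t - x 0 l| <= `|r j - x 0 l|.
    case/orP: tb => /andP[xt tj].
      by rewrite !ger0_norm ?subr_ge0 ?(le_trans xt) // lerB.
    by rewrite !ler0_norm ?subr_le0 ?(le_trans xt) // lerN2 lerB.
  set u := upd x l t in ct *.
  (* Product-rule splitting: the variation of the gradient brings in [Om] and [L l], that of the
     derivative of [phi] brings in [G] and [Ld l]. *)
  have -> : dh u - dh x =
     \sum_i (grad g (phi u) - grad g (phi x)) 0 i * (dphi u 0 i)%:C
     + \sum_i grad g (phi x) 0 i * ((dphi u - dphi x) 0 i)%:C.
    rewrite /dh -sumrB -big_split /=; apply: eq_bigr => i _.
    by rewrite !mxE rmorphB /=; ring.
  apply: le_trans (le_normcD _ _) _; apply: lerD.
    apply: le_trans (cnorm_cauchy_schwarz _ _) _; rewrite mulrC.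
    apply: ler_pM; rewrite ?rnorm_ge0 ?cnorm_ge0 //.
      exact: rnorm_vpartial_at (Llip l) (phid _ ct).
    (* Here [lam * delta = L l * |t - x 0 l|], the Lipschitz bound for [phi] along the axis. *)
    apply: le_trans (modulus_scale (lam := 2%:R * s * `|t - x 0 l|)
       (delta := L l / (2%:R * s)) (@cnorm0 R m) (@cnormN R m) (@cnormD R m)
       grad_bounded _ _ (phi_cube ct) (phi_cube cx) _) _ => //.
    - by rewrite !mulr_ge0 // ltW.
    - apply: le_trans (Ll _ _ ct cx _) _.
        by move=> i il; rewrite /u upd_out.
      rewrite /u upd_in le_eqVlt; apply/orP; left; apply/eqP.
      by field; rewrite gt_eqF.
    - by rewrite ler_wpM2r // lerD2l ler_wpM2l // mulr_ge0 // ltW.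
  apply: le_trans (cnorm_cauchy_schwarz _ _) _.
  apply: ler_pM; rewrite ?rnorm_ge0 ?cnorm_ge0 ?GM //; first exact: phi_cube.
  apply: le_trans (Ldl _ _ ct cx _) _.
    by move=> i il; rewrite /u upd_out.
  by rewrite /u upd_in ler_wpM2l.
have W1 := sum_bw n x l.
have -> : bernstein_coord n l h x - h x =
    \sum_(j < (n l).+1) (h (y j) - h x - (r j - x 0 l)%:C * dh x) * (bw x j)%:C.
  rewrite (eq_bigr (fun j : 'I_(n l).+1 => h (y j) * (bw x j)%:C -
     (h x * (bw x j)%:C + (bw x j * (r j - x 0 l))%:C * dh x))); last first.
    by move=> j _; move: (bw x j) (r j - x 0 l) => b d; rewrite rmorphM /=; ring.
  rewrite sumrB big_split /= -mulr_sumr -mulr_suml -!rmorph_sum /= W1.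
  by rewrite bernstein_centered // mul0r addr0 mulr1.
apply: le_trans (normc_sum _ _ _) _.
apply: (@le_trans _ _ (\sum_(j < (n l).+1)
   (L l * Om * (bw x j * `|r j - x 0 l|)
    + (L l * Om * (2%:R * s) + G * Ld l) * (bw x j * (r j - x 0 l) ^+ 2)))).
  apply: ler_sum => j _; have w0 : 0 <= bw x j by exact: bw_ge0.
  rewrite normcM normc_real [`|bw x j|]ger0_norm //.
  apply: le_trans (ler_wpM2r w0 (term j)) _.
  by rewrite -[(r j - x 0 l) ^+ 2](real_normK (num_real _)) le_eqVlt;
    apply/orP; left; apply/eqP; ring.
rewrite big_split /= -!mulr_sumr.
have c1 : 0 <= L l * Om by rewrite mulr_ge0.
have c2 : 0 <= L l * Om * (2%:R * s) + G * Ld l.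
  by rewrite addr_ge0 ?mulr_ge0 // ltW.
apply: le_trans (lerD (ler_wpM2l c1 (bernstein_abs (n_gt0 l) xl))
  (ler_wpM2l c2 (bernstein_variance (x 0 l) (n_gt0 l)))) _.
rewrite -/s nE -subr_ge0.
(* The two [L l * Om] contributions, [1 / (2 s)] each, add up to exactly [1 / s]; the [Ld l] term
   leaves half of its allowance as slack. *)
have -> : s^-1 * (L l * Om + G * (Ld l / (2%:R * s))) -
  (L l * Om / (2%:R * s) + (L l * Om * (2%:R * s) + G * Ld l) / (4%:R * s ^+ 2))
  = G * Ld l / (4%:R * s ^+ 2).
  by field; rewrite gt_eqF.
by rewrite divr_ge0 ?mulr_ge0 ?(ltW s0).
Qed.

End OneStepC1.

(** * Images of the Bernstein operator are C^1 *)

Section C1Algebra.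
Variables (R : realType) (m : nat).
Implicit Types (x : 'rV[R]_m) (f g D : 'rV[R]_m -> R[i]).

(** The derivative is a witness rather than a [lim], so that sums and products only combine
    convergence statements. *)
Definition has_partial f l D := continuous_on_cube D /\
  forall x, cube x -> cquot f l x t @[t --> increment l x] --> (D x : R[i]^o).

Definition C1 f := continuous_on_cube f /\ forall l, exists D, has_partial f l D.

(** By uniqueness of limits [cpartial f l] equals the witness on the cube, and continuity within the
    cube only sees those values. *)
Lemma C1_C1_on_cube f : C1 f -> C1_on_cube f.
Proof.
move=> [fc fD]; split; first exact: fc.
move=> l; have [D [Dc DP]] := fD l; split.
  by move=> x cx; apply/cvg_ex; exists (D x); exact: DP.
have fE x : cube x -> cpartial f l x = D x.
  move=> cx; have Fx := increment_proper l cx.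
  exact: (cvg_lim (@norm_hausdorff _ R[i]^o) (DP x cx)).
move/continuous_on_cubeP in Dc; apply/continuous_on_cubeP => x cx e e0.
by have := Dc x cx e e0; apply: filterS => y H cy; rewrite !fE //; exact: H.
Qed.

Lemma continuous_cube_cst (c : R[i]) : continuous_on_cube (fun _ : 'rV[R]_m => c).
Proof. by move=> x; exact: cvg_cst. Qed.

Lemma C1_cst (c : R[i]) : C1 (fun=> c).
Proof.
split=> [|l]; first exact: continuous_cube_cst.
exists (fun=> 0); split=> [|x cx]; first exact: continuous_cube_cst.
rewrite /cquot; under eq_fun do rewrite subrr mul0r.
exact: cvg_cst.
Qed.

Lemma cvg_increment l x (F : R -> R[i]^o) G (d : R[i]^o) :
  (forall t, t != 0 -> F t = G t) -> G @ increment l x --> d ->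
  F @ increment l x --> d.
Proof.
move=> FG /cvg_normcP Gd; apply/cvg_normcP => e e0.
have H : \forall t \near (0 : R), t != 0 -> cube (x + t *: delta_mx 0 l) ->
  normc (d - G t) < e := Gd e e0.
have : \forall t \near (0 : R), t != 0 -> cube (x + t *: delta_mx 0 l) ->
  normc (d - F t) < e.
  by apply: filterS H => t H t0; rewrite FG //; exact: H.
by [].
Qed.

Lemma C1_coord i : C1 (fun x => (x 0 i)%:C).
Proof.
split=> [|l].
  apply/continuous_on_cubeP => x cx e e0.
  apply/nbhs_ballP; exists e => // y [_ xy] _.
  have -> : (x 0 i)%:C - (y 0 i)%:C = (x 0 i - y 0 i)%:C by rewrite rmorphB.
  by rewrite normc_real; exact: xy.
exists (fun=> (i == l)%:R); split=> [|x cx]; first exact: continuous_cube_cst.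
(* At [t = 0] the quotient is 0 by the convention on division, even for [i = l]; the punctured
   filter ignores that value. *)
apply: (@cvg_increment l x _ (fun=> (i == l)%:R)); last exact: cvg_cst.
move=> t t0; have tC0 : t%:C != 0 by rewrite eq_complex /= negb_and t0.
rewrite /cquot !mxE eqxx /= -rmorphB /= addrAC subrr add0r rmorphM /=.
by rewrite mulrAC divff // mul1r rmorph_nat.
Qed.

Lemma C1_add f g : C1 f -> C1 g -> C1 (fun x => f x + g x).
Proof.
move=> [fc fD] [gc gD]; split=> [|l].
  by move=> x; apply: cvgD; [exact: fc|exact: gc].
have [D [Dc DP]] := fD l; have [E [Ec EP]] := gD l.
exists (fun x => D x + E x); split=> [x|x cx].
  by apply: cvgD; [exact: Dc|exact: Ec].
have Fx : Filter (increment l x) by have [] := increment_proper l cx.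
have -> : cquot (fun x => f x + g x) l x = cquot f l x \+ cquot g l x.
  by apply/funext => t; rewrite /cquot /= -mulrDl opprD addrACA.
by apply: cvgD; [exact: DP|exact: EP].
Qed.

Lemma cvg_shift f l x : cube x -> continuous_on_cube f ->
  (fun t => f (x + t *: delta_mx 0 l) : R[i]^o) @ increment l x
  --> (f x : R[i]^o).
Proof.
move=> cx /continuous_on_cubeP fc; apply/cvg_normcP => e e0.
have /nbhs_ballP[r /= r0 H] := fc x cx e e0.
have : \forall t \near (0 : R), t != 0 -> cube (x + t *: delta_mx 0 l) ->
  normc (f x - f (x + t *: delta_mx 0 l)) < e.
  apply/nbhs_ballP; exists r => // t bt _; apply: H; split=> // a i.
  rewrite [a]ord1 shiftE mxE; case: eqP => [->|_]; last exact: ballxx.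
  by move: bt; rewrite /ball /= sub0r opprD addrA subrr sub0r.
by [].
Qed.

Lemma C1_mul f g : C1 f -> C1 g -> C1 (fun x => f x * g x).
Proof.
move=> [fc fD] [gc gD]; split=> [|l].
  by move=> x; apply: cvgM; [exact: fc|exact: gc].
have [D [Dc DP]] := fD l; have [E [Ec EP]] := gD l.
exists (fun x => D x * g x + f x * E x); split=> [x|x cx].
  by apply: cvgD; apply: cvgM; [exact: Dc|exact: gc|exact: fc|exact: Ec].
have Fx : Filter (increment l x) by have [] := increment_proper l cx.
(* Leibniz form with [g] at the shifted point, whose limit is given by [cvg_shift]. *)
have -> : cquot (fun x => f x * g x) l x =
  (fun t => cquot f l x t * g (x + t *: delta_mx 0 l) + f x * cquot g l x t).
  apply/funext => t; rewrite /cquot [LHS]mulrC [RHS]addrC; ring.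
apply: cvgD; apply: cvgM; [exact: DP|exact: cvg_shift|exact: cvg_cst|exact: EP].
Qed.

Lemma C1_sum (I : Type) (r : seq I) (F : I -> 'rV[R]_m -> R[i]) :
  (forall i, C1 (F i)) -> C1 (fun x => \sum_(i <- r) F i x).
Proof.
move=> FC; elim: r => [|i r IH].
  under eq_fun do rewrite big_nil; exact: C1_cst.
under eq_fun do rewrite big_cons; exact: C1_add.
Qed.

Lemma C1_prod (I : Type) (r : seq I) (F : I -> 'rV[R]_m -> R[i]) :
  (forall i, C1 (F i)) -> C1 (fun x => \prod_(i <- r) F i x).
Proof.
move=> FC; elim: r => [|i r IH].
  under eq_fun do rewrite big_nil; exact: C1_cst.
under eq_fun do rewrite big_cons; exact: C1_mul.
Qed.

Lemma C1_exp f p : C1 f -> C1 (fun x => f x ^+ p).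
Proof.
move=> fC; elim: p => [|p IH]; first exact: C1_cst.
under eq_fun do rewrite exprS; exact: C1_mul.
Qed.

(** A polynomial in the coordinates, whatever [h] is; this supplies the regularity of the iterates
    [(B K)^j f] for [j >= 1]. *)
Lemma C1_bernstein n (h : 'rV[R]_m -> R[i]) : C1_on_cube (bernstein n h).
Proof.
apply: C1_C1_on_cube; apply: C1_sum => k.
apply: C1_mul; first exact: C1_cst.
under eq_fun do rewrite rmorph_prod; apply: C1_prod => l.
rewrite /bernstein_poly; under eq_fun do rewrite !rmorphM !rmorphXn rmorphB /=.
apply: C1_mul; first by apply: C1_mul; [exact: C1_cst|exact/C1_exp/C1_coord].
apply: C1_exp; apply: C1_add; first exact: C1_cst.
under eq_fun do rewrite -mulN1r.
by apply: C1_mul; [exact: C1_cst|exact: C1_coord].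
Qed.

End C1Algebra.

(** * Telescoping over the iterates, and the theorem *)

Lemma supnorm_le (R : realType) (m : nat) (W : Type) (N : W -> R)
    (g : 'rV[R]_m -> W) C :
  (forall x, cube x -> N (g x) <= C) -> supnorm N g <= C.
Proof.
move=> gC; apply: ge_sup; first by exists (N (g 0)), 0 => //; exact: cube0.
by move=> _ [x cx <-]; exact: gC.
Qed.

(** Induction on the pointwise bound: splitting off the outermost step leaves the error of order [k]
    evaluated at [phi x], which is again in the cube. *)
Lemma iter_error (R : realType) (m : nat) (phi : 'rV[R]_m -> 'rV[R]_m)
    (B : ('rV[R]_m -> R[i]) -> 'rV[R]_m -> R[i]) (f : 'rV[R]_m -> R[i])
    (E : nat -> R) k :
  let K := koopman phi in
  let BK := fun g => B (K g) in
  (forall x, cube x -> cube (phi x)) ->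
  (forall j x, cube x ->
     normc (BK (iter j BK f) x - K (iter j BK f) x) <= E j) ->
  supnorm (@normc R) (fun x => iter k BK f x - iter k K f x)
  <= \sum_(0 <= j < k) E j.
Proof.
move=> K BK phi_cube HE; apply: supnorm_le; elim: k => [|k IH] x cx.
  by rewrite big_geq // subrr normc0.
rewrite big_nat_recr //= addrC.
have -> : BK (iter k BK f) x - K (iter k K f) x =
  (BK (iter k BK f) x - K (iter k BK f) x)
  + (iter k BK f (phi x) - iter k K f (phi x)).
  by rewrite /K /koopman /= addrA subrK.
by apply: le_trans (le_normcD _ _) (lerD (HE _ _ cx) (IH _ (phi_cube _ cx))).
Qed.

Theorem theorem4p6 (R : realType) (m : nat) (m_ge1 : (1 <= m)%N)
    (phi : 'rV[R]_m -> 'rV[R]_m)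
    (phi_cube : forall x, cube x -> cube (phi x))
    (Lphi : R) (Lphi_lip : lipschitz_const phi Lphi)
    (Lpart : 'I_m -> R)
    (Lpart_lip : forall l, partial_lipschitz_const l phi (Lpart l))
    (n : 'I_m -> nat) (n_gt0 : forall l, (0 < n l)%N) :
  let K := koopman phi in
  let BK := fun g : 'rV[R]_m -> R[i] => bernstein n (K g) in
  let err := fun (k : nat) (f : 'rV[R]_m -> R[i]) =>
    supnorm (@normc R) (fun x => iter k BK f x - iter k K f x) in
  (forall f : 'rV[R]_m -> R[i], continuous_on_cube f ->
   forall k : nat, (1 <= k)%N ->
     err k f <=
       3%:R / 2%:R * \sum_(0 <= j < k)
         modulus (@normc R) (iter j BK f)
           (Lphi * Num.sqrt (\sum_(l < m) (n l)%:R^-1))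
     /\
     err k f <=
       3%:R / 2%:R * \sum_(0 <= j < k) \sum_(l < m)
         modulus (@normc R) (iter j BK f) (Lpart l / Num.sqrt (n l)%:R))
  /\
  (forall Ldpart : 'I_m -> R,
   (forall l, vpartial_exists phi l) ->
   (forall l, exists L : R, lipschitz_const (vpartial phi l) L) ->
   (forall l, partial_lipschitz_const l (vpartial phi l) (Ldpart l)) ->
   forall f : 'rV[R]_m -> R[i], C1_on_cube f ->
   forall k : nat, (1 <= k)%N ->
     err k f <=
       \sum_(0 <= j < k) \sum_(l < m)
         (Num.sqrt (n l)%:R)^-1 *
         (Lpart l * modulus (@cnorm R m) (grad (iter j BK f))
                      (Lpart l / (2%:R * Num.sqrt (n l)%:R))
          + supnorm (@cnorm R m) (grad (iter j BK f))
            * (Ldpart l / (2%:R * Num.sqrt (n l)%:R)))).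
Proof.
move=> K BK err; split=> [f fc k _|Ldpart phi_diff _ Ldlip f fC k _].
  (* For [j = 0] this is the continuity of [f]; later iterates are images of the Bernstein
     operator. *)
  have fb j : bounded_on_cube (@normc R) (iter j BK f).
    apply: continuous_bounded; case: j => [//|j] /=.
    by have [] := C1_bernstein n (K (iter j BK f)).
  rewrite !mulr_sumr; split; apply: (iter_error (B := bernstein n)) => // j x cx.
    exact: (one_step_full phi_cube n_gt0 (fb j)).
  exact: (one_step_partial phi_cube n_gt0 (fb j)).
have fC1 j : C1_on_cube (iter j BK f).
  by case: j => [//|j]; exact: C1_bernstein.
apply: (iter_error (B := bernstein n)); first exact: phi_cube.
move=> j x cx.
exact: (one_step_C1 phi_cube n_gt0 Lpart_lip phi_diff Ldlip (fC1 j) cx).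
Qed.
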